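(* For $x\in\mathbb{R}$, $n\in\{0,1,2,\ldots\}$ and real $\kappa>0$, $$\mathrm{Mi}_{\kappa+n,\,\kappa-1/2}(x)=2^{\kappa}\sum_{m=0}^{n}\binom{n}{m}\frac{(-2)^m}{(2\kappa)_m}\,\gamma\left(\kappa+m,\,x/2\right).$$
   Context: The Whittaker function is $\mathrm{M}_{\kappa,\mu}(x)=x^{\mu+1/2}e^{-x/2}\,{}_1F_1\!\left(\tfrac12+\mu-\kappa;\,1+2\mu;\,x\right)$, $2\mu\neq-1,-2,\ldots$, and the integral Whittaker function is $\mathrm{Mi}_{\kappa,\mu}(x)=\int_0^x\frac{\mathrm{M}_{\kappa,\mu}(t)}{t}dt$. $\gamma(\nu,z)=\int_0^zt^{\nu-1}e^{-t}dt$ is the lower incomplete gamma function and $(a)_m=a(a+1)\cdots(a+m-1)$ the Pochhammer symbol. For negative $x$, integrals are along the real segment and powers are taken with the principal branch. *)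

(* Defs.v *)
(* Stdlib reals + Coquelicot. *)
From Stdlib Require Import Reals Factorial.
From Coquelicot Require Import Coquelicot.

Open Scope R_scope.

Fixpoint poch (a : R) (m : nat) : R :=
  match m with
  | O => 1
  | S k => poch a k * (a + INR k)
  end.

(* Meaningful when b is not a nonpositive integer; the series then converges
   for every x. *)
Definition hyp1F1 (a b x : R) : R :=
  PSeries (fun k => poch a k / (poch b k * INR (fact k))) x.

(* Principal branch of x^a for real x and a: arg x = PI when x < 0.
   At x = 0 the value is 0^0 = 1 and 0^a = 0 for a > 0; the value 0 for a < 0
   is conventional and is never used by the improper integrals below. *)
Definition cpow_principal (x a : R) : C :=
  if Rlt_dec 0 x then RtoC (Rpower x a)
  else if Rlt_dec x 0 then
    Cmult (RtoC (Rpower (- x) a)) (cos (a * PI), sin (a * PI))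
  else if Req_EM_T a 0 then RtoC 1 else RtoC 0.

(* Improper integral of f from 0 to x, for x of either sign: the lower endpoint
   s * x tends to 0 inside the real segment between 0 and x as s -> 0+.  The
   filter is at_right 0 up to equivalence for x > 0, at_left 0 for x < 0, and
   at_point 0 for x = 0, where the integral is 0. *)
Definition int_from_0 (f : R -> C) (x : R) : C :=
  @RInt_gen C_R_CompleteNormedModule f
    (filtermap (fun s => s * x) (at_right 0)) (at_point x).

(* Meaningful when 2 * mu is not a negative integer. *)
Definition whittakerM (kappa mu x : R) : C :=
  Cmult (cpow_principal x (mu + 1 / 2))
    (RtoC (exp (- x / 2) * hyp1F1 (1 / 2 + mu - kappa) (1 + 2 * mu) x)).

Definition whittakerMi (kappa mu x : R) : C :=
  int_from_0 (fun t => Cdiv (whittakerM kappa mu t) (RtoC t)) x.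

Definition lower_gamma (nu z : R) : C :=
  int_from_0 (fun t => Cmult (cpow_principal t (nu - 1)) (RtoC (exp (- t)))) z.

(* Main.v *)
Require Import Defs.
From Stdlib Require Import ssreflect Reals Factorial Lra Lia.
From Coquelicot Require Import Coquelicot.

Open Scope R_scope.
Open Scope general_if_scope.

(** Since [1F1(-n; 2 kappa; t)] is a polynomial, the integrand of [Mi] is the
    finite combination of the terms [t^(kappa+m-1) e^(-t/2)] for [m <= n], and
    [t = 2u] turns each of them into the integrand of a lower incomplete gamma
    function.  On the whole line the principal branch satisfies
    [t^(a+1) = t t^a] for [t <> 0] and [(ut)^a = u^a t^a] for [u > 0], so no
    case distinction on the sign of [x] is needed.  What remains is the
    convergence at [0]: integration by parts replaces [s^(nu-1)] by [s^nu],
    which is continuous at [0]. *)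

(** * Calculus of the improper integral from 0 *)

Definition is_int_from_0 {V : NormedModule R_AbsRing} (f : R -> V) (x : R)
  (l : V) : Prop :=
  is_RInt_gen f (filtermap (fun s => s * x) (at_right 0)) (at_point x) l.

(** [is_int_from_0] asserts convergence, whereas [int_from_0] has some value even for a divergent
    integral; the work is done on the relation and transferred here. *)
Lemma int_from_0_unique (f : R -> C) (x : R) (l : C) :
  @is_int_from_0 C_R_CompleteNormedModule f x l -> int_from_0 f x = l.
Proof.
  intros H. unfold int_from_0.
  now apply (@is_RInt_gen_unique C_R_CompleteNormedModule _ _ _ _ f l).
Qed.

Lemma is_int_from_0_0 {V : NormedModule R_AbsRing} (f : R -> V) :
  is_int_from_0 f 0 zero.
Proof.
  intros P HP.
  apply Filter_prod with (fun y => y = 0) (fun y => y = 0).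
  - exists (mkposreal 1 Rlt_0_1). intros s _ _. apply Rmult_0_r.
  - reflexivity.
  - intros a b -> ->. exists zero. split.
    + apply (is_RInt_point f 0).
    + now apply locally_singleton.
Qed.

(** The segment between [s * x] and [x] avoids 0, so [t] may be taken strictly on the side of [x].
    This provides the [t <> 0] that the power identities require. *)
Lemma is_int_from_0_ext {V : NormedModule R_AbsRing} (f g : R -> V) (x : R)
  (l : V) :
  (forall t, 0 < t * x -> f t = g t) -> is_int_from_0 f x l -> is_int_from_0 g x l.
Proof.
  intros Hfg. apply is_RInt_gen_ext.
  apply Filter_prod with
    (fun y => exists s, 0 < s /\ y = s * x) (fun y => y = x).
  - exists (mkposreal 1 Rlt_0_1). intros s _ Hs. now exists s.
  - reflexivity.
  - intros a b (s & Hs & ->) -> t Ht. apply Hfg. simpl in Ht.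
    destruct (Rtotal_order x 0) as [Hx|[->|Hx]].
    + assert (t < 0); [|nra].
      apply Rlt_le_trans with (1 := proj2 Ht). apply Rmax_lub; nra.
    + rewrite Rmult_0_r Rmin_left ?Rmax_left in Ht; lra.
    + assert (0 < t); [|nra].
      apply Rle_lt_trans with (2 := proj1 Ht). apply Rmin_glb; nra.
Qed.

(** Multiplication by [u] carries the endpoint [s * x] to [s * (u * x)], so the substitution works
    for either sign of [u]. *)
Lemma is_int_from_0_scale {V : NormedModule R_AbsRing} (f : R -> V) (u x : R)
  (l : V) :
  is_int_from_0 f (u * x) l ->
  is_int_from_0 (fun t => scal u (f (u * t))) x l.
Proof.
  intros H P HP. destruct (H P HP) as [Q S HQ HS HQS].
  apply Filter_prod with (fun y => Q (u * y)) (fun y => y = x).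
  - unfold filtermap in HQ |- *.
    apply: filter_imp HQ => s Hs.
    replace (u * (s * x)) with (s * (u * x)) by ring. exact Hs.
  - reflexivity.
  - intros a b Ha ->. destruct (HQS _ _ Ha HS) as (y & Hy & HPy).
    exists y. split; [|exact HPy]. simpl in *.
    apply is_RInt_ext with (fun t => scal u (f (u * t + 0))).
    + intros t _. now rewrite Rplus_0_r.
    + apply is_RInt_comp_lin. now rewrite !Rplus_0_r.
Qed.

Lemma is_int_from_0_Cmult (f : R -> C) (r x : R) (l : C) :
  @is_int_from_0 C_R_CompleteNormedModule f x l ->
  @is_int_from_0 C_R_CompleteNormedModule
    (fun t => Cmult (RtoC r) (f t)) x (Cmult (RtoC r) l).
Proof.
  intros H. rewrite -scal_R_Cmult.
  apply is_int_from_0_ext with (fun t => scal r (f t)).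
  - intros t _. apply scal_R_Cmult.
  - now apply (is_RInt_gen_scal (V := C_R_CompleteNormedModule)).
Qed.

(* The monoid structure on [C] under [C_R_CompleteNormedModule] is that of the
   product [R * R], whereas [sum_n] on [C] infers [C_AbelianMonoid]; this is why
   the sum is not taken in an arbitrary normed module. *)
Lemma is_int_from_0_sum_n (f : nat -> R -> C) (x : R) (l : nat -> C) (n : nat) :
  (forall m, @is_int_from_0 C_R_CompleteNormedModule (f m) x (l m)) ->
  @is_int_from_0 C_R_CompleteNormedModule
    (fun t => sum_n (fun m => f m t) n) x (sum_n l n).
Proof.
  intros H. induction n as [|n IH].
  - rewrite sum_O.
    apply is_int_from_0_ext with (f 0%nat); [|apply H].
    intros t _. now rewrite sum_O.
  - rewrite sum_Sn.
    apply is_int_from_0_ext with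
      (fun t => Cplus (sum_n (fun m => f m t) n) (f (S n) t)).
    + intros t _. now rewrite sum_Sn.
    + apply (is_RInt_gen_plus (V := C_R_CompleteNormedModule)); [exact IH|apply H].
Qed.

(** * Convergence at 0 of a power times an exponential *)

Lemma is_int_from_0_derive {V : CompleteNormedModule R_AbsRing}
  (F f : R -> V) :
  (forall s, 0 < s -> is_derive F s (f s)) ->
  (forall s, 0 < s -> continuous f s) ->
  continuous F 0 ->
  is_int_from_0 f 1 (minus (F 1) (F 0)).
Proof.
  intros HD Hf H0 P HP.
  assert (Hlim : filterlim (fun s => minus (F 1) (F s)) (locally 0)
                   (locally (minus (F 1) (F 0)))).
  { apply: (continuous_minus (fun _ => F 1) F 0).
    - apply continuous_const.
    - exact H0. }
  apply Filter_prod with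
    (fun s => 0 < s /\ P (minus (F 1) (F s))) (fun y => y = 1).
  - unfold filtermap, at_right, within.
    generalize (Hlim P HP). unfold filtermap. apply filter_imp.
    intros s Hs Hpos. rewrite Rmult_1_r. now split.
  - reflexivity.
  - intros a b (Ha & HPa) ->. exists (minus (F 1) (F a)).
    split; [|exact HPa].
    (* The segment from [a] to 1 stays away from 0, where [F] is only known to be continuous. *)
    assert (Hmin : 0 < Rmin a 1) by (apply Rmin_glb_lt; lra).
    apply (is_RInt_derive F f a 1); intros s Hs; [apply HD|apply Hf]; lra.
Qed.

(** For [s <= 0] the convention [ln s = 0] would give [Rpower s nu] the value 1; extending by 0
    instead yields continuity on both sides of 0. *)
Lemma continuous_Rpower_ext_0 (nu : R) : 0 < nu -> forall x : R,
  continuous (fun s => if Rlt_dec 0 s then Rpower s nu else 0) x.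
Proof.
  intros Hnu x. destruct (Rtotal_order x 0) as [Hx|[->|Hx]].
  - apply continuous_ext_loc with (fun _ => 0).
    + generalize (open_lt 0 x Hx). apply filter_imp. intros s Hs.
      destruct (Rlt_dec 0 s); lra.
    + apply continuous_const.
  - intros P [eps HP]. destruct (Rlt_dec 0 0) as [|_] in HP; [lra|].
    (* The radius [d] solves [d ^ nu = eps]. *)
    assert (Hd : 0 < Rpower eps (/ nu)) by apply exp_pos.
    exists (mkposreal _ Hd). intros s Hs. apply HP.
    change (Rabs ((if Rlt_dec 0 s then Rpower s nu else 0) - 0) < eps).
    change (Rabs (s - 0) < Rpower eps (/ nu)) in Hs.
    rewrite Rminus_0_r in Hs. rewrite Rminus_0_r.
    destruct (Rlt_dec 0 s) as [Hpos|_].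
    + rewrite Rabs_pos_eq; [|apply Rlt_le, exp_pos].
      rewrite Rabs_pos_eq in Hs; [|lra].
      replace (pos eps) with (Rpower (Rpower eps (/ nu)) nu).
      * now apply Rlt_Rpower_l.
      * rewrite Rpower_mult Rinv_l; [|lra]. apply Rpower_1, cond_pos.
    + rewrite Rabs_R0. apply cond_pos.
  - apply continuous_ext_loc with (fun s => Rpower s nu).
    + generalize (open_gt 0 x Hx). apply filter_imp. intros s Hs.
      destruct (Rlt_dec 0 s); lra.
    + apply: ex_derive_continuous. eexists. apply is_derive_Reals.
      now apply derivable_pt_lim_power.
Qed.

(** This is the gamma integral up to [z] after substituting [t = s z]: the real variable [s] runs
    over (0, 1), and the vector [c] absorbs the complex phase. *)
Lemma ex_int_from_0_Rpower_exp {V : CompleteNormedModule R_AbsRing}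
  (nu z : R) (c : V) : 0 < nu ->
  exists l, is_int_from_0
    (fun s => scal (Rpower s (nu - 1) * exp (- (z * s))) c) 1 l.
Proof.
  intros Hnu.
  set (p := fun s => if Rlt_dec 0 s then Rpower s nu else 0).
  set (h := fun s => p s * exp (- (z * s))).
  assert (Hexp : forall s, is_derive (fun s => exp (- (z * s))) s
                             (- z * exp (- (z * s)))).
  { intros s. auto_derive; [trivial|ring]. }
  assert (Hh : forall s, continuous h s).
  { intros s. apply: (continuous_mult p).
    - now apply continuous_Rpower_ext_0.
    - apply: ex_derive_continuous. eexists. apply Hexp. }
  assert (HI : forall s, is_derive (fun s => RInt h 0 s) s (h s)).
  { intros s. apply is_derive_RInt with 0; [|apply Hh].
    apply filter_forall. intros y. apply: RInt_correct.
    apply: ex_RInt_continuous. intros; apply Hh. }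
  (* Integration by parts: the derivative of [exp (- (z * s))] in the first term produces
     [- z / nu * h s], which the second term cancels. *)
  set (G := fun s => / nu * h s + z / nu * RInt h 0 s).
  eexists.
  apply (is_int_from_0_derive (fun s => scal (G s) c)).
  - intros s Hs. apply: is_derive_scal_l.
    apply is_derive_ext_loc with
      (fun s => / nu * (Rpower s nu * exp (- (z * s))) + z / nu * RInt h 0 s).
    + generalize (open_gt 0 s Hs). apply filter_imp. intros y Hy.
      unfold G, h, p. destruct (Rlt_dec 0 y); [reflexivity|lra].
    + evar_last.
      * apply: is_derive_plus.
        -- apply: is_derive_scal. apply: is_derive_mult.
           ++ apply is_derive_Reals. now apply derivable_pt_lim_power.
           ++ apply Hexp.
           ++ intros; apply Rmult_comm.
        -- apply: is_derive_scal. apply HI.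
      * unfold h, p. destruct (Rlt_dec 0 s); [|lra].
        unfold plus, mult, scal; simpl. unfold mult; simpl. field. lra.
  - intros s Hs. apply: continuous_scal_l. apply: ex_derive_continuous.
    eexists. apply: is_derive_mult.
    + apply is_derive_Reals. now apply derivable_pt_lim_power.
    + apply Hexp.
    + intros; apply Rmult_comm.
  - apply: continuous_scal_l. apply: continuous_plus.
    + apply: (continuous_scal_r (/ nu)). apply Hh.
    + apply: (continuous_scal_r (z / nu)). apply: ex_derive_continuous.
      eexists. apply HI.
Qed.

(** * Principal powers and the incomplete gamma integral *)

Lemma cpow_principal_scale (u t a : R) : 0 < u -> t <> 0 ->
  cpow_principal (u * t) a = Cmult (RtoC (Rpower u a)) (cpow_principal t a).
Proof.
  intros Hu Ht. unfold cpow_principal.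
  destruct (Rlt_dec 0 t) as [H|H].
  - destruct (Rlt_dec 0 (u * t)) as [_|]; [|nra].
    rewrite -Rpower_mult_distr; [|lra..]. apply RtoC_mult.
  - destruct (Rlt_dec 0 (u * t)); [nra|].
    destruct (Rlt_dec t 0); [|lra].
    destruct (Rlt_dec (u * t) 0) as [_|]; [|nra].
    rewrite Cmult_assoc -RtoC_mult Rpower_mult_distr; [|lra..].
    do 3 f_equal. ring.
Qed.

(** For [t < 0], adding [PI] to the angle flips the signs of cosine and sine, which matches
    [t = - |t|]. *)
Lemma cpow_principal_succ (t a : R) : t <> 0 ->
  cpow_principal t (a + 1) = Cmult (RtoC t) (cpow_principal t a).
Proof.
  intros Ht. unfold cpow_principal.
  destruct (Rlt_dec 0 t) as [H|H].
  - rewrite Rpower_plus Rpower_1; [|lra]. rewrite RtoC_mult. ring.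
  - destruct (Rlt_dec t 0); [|lra].
    rewrite Rpower_plus Rpower_1; [|lra].
    replace ((a + 1) * PI) with (a * PI + PI) by ring.
    rewrite neg_cos neg_sin.
    unfold Cmult, RtoC; simpl. f_equal; ring.
Qed.

Lemma cpow_principal_plus_nat (t a : R) (m : nat) : t <> 0 ->
  cpow_principal t (a + INR m) = Cmult (RtoC (t ^ m)) (cpow_principal t a).
Proof.
  intros Ht. induction m as [|m IH].
  - simpl. rewrite Rplus_0_r. ring.
  - rewrite S_INR -Rplus_assoc (cpow_principal_succ _ _ Ht) IH.
    simpl. rewrite RtoC_mult. ring.
Qed.

Lemma lower_gamma_correct (nu z : R) : 0 < nu ->
  @is_int_from_0 C_R_CompleteNormedModule
    (fun t => Cmult (cpow_principal t (nu - 1)) (RtoC (exp (- t)))) z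
    (lower_gamma nu z).
Proof.
  intros Hnu.
  set (f := fun t => Cmult (cpow_principal t (nu - 1)) (RtoC (exp (- t)))).
  assert (Hex : exists l, @is_int_from_0 C_R_CompleteNormedModule f z l).
  { destruct (Req_dec z 0) as [->|Hz].
    { eexists. apply is_int_from_0_0. }
    (* The factor [z] comes from [dt = z ds], the other from [(s z)^(nu-1) = s^(nu-1) z^(nu-1)],
       valid since [s > 0]. *)
    destruct (@ex_int_from_0_Rpower_exp C_R_CompleteNormedModule nu z
                (Cmult (RtoC z) (cpow_principal z (nu - 1))) Hnu) as [l Hl].
    exists l.
    rewrite -[X in is_int_from_0 _ X](Rinv_l z Hz) in Hl.
    apply is_int_from_0_scale in Hl.
    revert Hl. apply is_int_from_0_ext. intros t Ht.
    assert (Hu : 0 < / z * t).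
    { replace (/ z * t) with (t * z * (/ z) ^ 2) by (field; exact Hz).
      apply Rmult_lt_0_compat; [exact Ht|].
      now apply pow2_gt_0, Rinv_neq_0_compat. }
    replace (z * (/ z * t)) with t by (field; exact Hz).
    unfold f. replace t with (/ z * t * z) at 3 by (field; exact Hz).
    rewrite (cpow_principal_scale _ _ _ Hu Hz).
    rewrite !scal_R_Cmult !RtoC_mult RtoC_inv; [|exact Hz].
    apply: (_ : _ = _ :> C). field. now intros H%RtoC_inj. }
  destruct Hex as [l Hl]. unfold lower_gamma.
  rewrite (int_from_0_unique f z l Hl). exact Hl.
Qed.

(** * The terminating Kummer series *)

Lemma poch_opp_nat_le (n k : nat) : (k <= n)%nat ->
  poch (- INR n) k * INR (fact (n - k)) = (-1) ^ k * INR (fact n).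
Proof.
  induction k as [|k IH]; intros Hk.
  - simpl poch. rewrite Nat.sub_0_r. simpl. ring.
  - simpl poch. simpl pow. rewrite !Rmult_assoc -IH; [|lia].
    replace (n - k)%nat with (S (n - S k)) by lia.
    rewrite fact_simpl mult_INR S_INR minus_INR; [|lia].
    rewrite S_INR. ring.
Qed.

Lemma poch_opp_nat_gt (n k : nat) : (n < k)%nat -> poch (- INR n) k = 0.
Proof.
  induction 1 as [|k _ IH]; simpl.
  - ring.
  - rewrite IH. ring.
Qed.

Lemma poch_pos (a : R) (m : nat) : 0 < a -> 0 < poch a m.
Proof.
  intros Ha. induction m as [|m IH]; simpl.
  - lra.
  - apply Rmult_lt_0_compat; [exact IH|].
    generalize (pos_INR m). lra.
Qed.

Lemma PSeries_finite (a : nat -> R) (n : nat) (x : R) :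
  (forall k, (n < k)%nat -> a k = 0) ->
  PSeries a x = sum_n (fun k => a k * x ^ k) n.
Proof.
  intros Ha. apply is_pseries_unique, is_pseries_R.
  apply (is_series_decr_n _ (S n)); [lia|]. simpl Init.Nat.pred.
  rewrite plus_opp_r.
  apply is_series_ext with (fun _ => 0).
  - intros k. rewrite Ha; [|lia]. now rewrite Rmult_0_l.
  - apply is_series_Reals. intros eps Heps. exists 0%nat. intros k _.
    unfold R_dist. rewrite sum_cte Rmult_0_l Rminus_0_r Rabs_R0. exact Heps.
Qed.

(** The factor [- n + n] kills every term beyond [n]; for [m <= n] the quotient of [poch (- n) m] by
    [m!] is the signed binomial coefficient. *)
Lemma hyp1F1_opp_nat (n : nat) (b x : R) : 0 < b ->
  hyp1F1 (- INR n) b x =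
  sum_n (fun m => Binomial.C n m * ((-1) ^ m / poch b m) * x ^ m) n.
Proof.
  intros Hb. unfold hyp1F1. rewrite (PSeries_finite _ n).
  - apply sum_n_ext_loc. intros m Hm. f_equal.
    assert (Hp := poch_pos b m Hb).
    assert (H1 := INR_fact_neq_0 m). assert (H2 := INR_fact_neq_0 (n - m)).
    unfold Binomial.C.
    replace (poch (- INR n) m) with ((-1) ^ m * INR (fact n) / INR (fact (n - m))).
    + field. lra.
    + rewrite -(poch_opp_nat_le n m Hm). field. exact H2.
  - intros k Hk. rewrite poch_opp_nat_gt; [|exact Hk]. unfold Rdiv. ring.
Qed.

Lemma sum_n_Cmult_r (u : nat -> R) (a : C) (n : nat) :
  sum_n (fun k => Cmult (RtoC (u k)) a) n = Cmult (RtoC (sum_n u n)) a.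
Proof.
  induction n as [|n IH].
  - now rewrite !sum_O.
  - rewrite !sum_Sn IH.
    change (plus (sum_n u n) (u (S n))) with (sum_n u n + u (S n)).
    rewrite RtoC_plus Cmult_plus_distr_r. reflexivity.
Qed.

(** * The Whittaker integrand and its integration *)

Lemma whittakerM_div_eq_sum (kappa t : R) (n : nat) : 0 < kappa -> t <> 0 ->
  Cdiv (whittakerM (kappa + INR n) (kappa - 1 / 2) t) (RtoC t) =
  Cmult (RtoC (Rpower 2 kappa))
    (sum_n (fun m =>
       Cmult (RtoC (Binomial.C n m * ((-2) ^ m / poch (2 * kappa) m)))
         (Cmult (RtoC (/ 2))
           (Cmult (cpow_principal (/ 2 * t) (kappa + INR m - 1))
             (RtoC (exp (- (/ 2 * t))))))) n).
Proof.
  intros Hk Ht.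
  (* The prefactor, the Jacobian of [t = 2u] and the rescaled power cancel together. *)
  assert (H2 : Rpower 2 kappa * / 2 * Rpower (/ 2) (kappa - 1) = 1).
  { replace kappa with (kappa - 1 + 1) at 1 by ring.
    rewrite Rpower_plus Rpower_1; [|lra].
    replace (Rpower 2 (kappa - 1) * 2 * / 2 * Rpower (/ 2) (kappa - 1))
      with (Rpower 2 (kappa - 1) * Rpower (/ 2) (kappa - 1)) by field.
    rewrite Rpower_mult_distr; [|lra..].
    rewrite Rinv_r; [|lra]. unfold Rpower. now rewrite ln_1 Rmult_0_r exp_0. }
  set (W := Cmult (cpow_principal t (kappa - 1)) (RtoC (exp (- t / 2)))).
  transitivity (Cmult (RtoC (hyp1F1 (- INR n) (2 * kappa) t)) W).
  - unfold whittakerM, W.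
    replace (kappa - 1 / 2 + 1 / 2) with (kappa - 1 + 1) by field.
    rewrite (cpow_principal_succ _ _ Ht).
    (* The first parameter is a nonpositive integer, so the series terminates. *)
    replace (1 / 2 + (kappa - 1 / 2) - (kappa + INR n)) with (- INR n) by field.
    replace (1 + 2 * (kappa - 1 / 2)) with (2 * kappa) by field.
    rewrite RtoC_mult. field. now intros H%RtoC_inj.
  - rewrite hyp1F1_opp_nat; [|lra].
    rewrite -sum_n_Cmult_r.
    etransitivity; [|apply (sum_n_mult_l (K := C_Ring))].
    apply sum_n_ext. intros m. unfold W.
    replace (kappa + INR m - 1) with (kappa - 1 + INR m) by ring.
    rewrite cpow_principal_plus_nat; [|lra].
    rewrite cpow_principal_scale; [|lra|exact Ht].
    replace (- (/ 2 * t)) with (- t / 2) by field.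
    replace (Binomial.C n m * ((-1) ^ m / poch (2 * kappa) m) * t ^ m) with
      (Binomial.C n m * ((-2) ^ m / poch (2 * kappa) m) * (/ 2 * t) ^ m
        * (Rpower 2 kappa * / 2 * Rpower (/ 2) (kappa - 1))).
    + rewrite !RtoC_mult. apply: (_ : _ = Cmult _ _). ring.
    + rewrite H2. replace (-2) with (-1 * 2) by ring.
      rewrite !Rpow_mult_distr pow_inv. field. split.
      * apply Rgt_not_eq, poch_pos. lra.
      * apply pow_nonzero. lra.
Qed.

Theorem theorem35 (x kappa : R) (n : nat) (hkappa : 0 < kappa) :
  whittakerMi (kappa + INR n) (kappa - 1 / 2) x =
  Cmult (RtoC (Rpower 2 kappa))
    (sum_n (fun m : nat =>
       Cmult (RtoC (Binomial.C n m * ((-2) ^ m / poch (2 * kappa) m)))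
         (lower_gamma (kappa + INR m) (x / 2))) n).
Proof.
  apply int_from_0_unique.
  eapply is_int_from_0_ext.
  { intros t Ht. symmetry. apply (whittakerM_div_eq_sum kappa t n hkappa).
    intros ->. lra. }
  apply is_int_from_0_Cmult, is_int_from_0_sum_n. intros m.
  apply is_int_from_0_Cmult.
  (* The remaining [/ 2] is the Jacobian, and the substitution moves the endpoint [x] to [x / 2]. *)
  apply is_int_from_0_ext with (fun t => scal (/ 2)
    (Cmult (cpow_principal (/ 2 * t) (kappa + INR m - 1))
      (RtoC (exp (- (/ 2 * t)))))).
  { intros t _. apply scal_R_Cmult. }
  apply (@is_int_from_0_scale C_R_CompleteNormedModule
    (fun t => Cmult (cpow_principal t (kappa + INR m - 1)) (RtoC (exp (- t))))).
  replace (/ 2 * x) with (x / 2) by field.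
  apply lower_gamma_correct. generalize (pos_INR m). lra.
Qed.
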